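(* Let $N\ge 2$, $p\ge 2$, $0<r_0<R_0\le\infty$, $\Omega=B]r_0,R_0[$, and let $V\in C(\Omega)$ satisfy either $V>0$ in $\Omega$ or $V\equiv 0$ in $\Omega$. Assume that condition $( * )$ holds and that there exists a positive radial strictly monotone decreasing $C^2$-supersolution of $-\Delta_p w-V|w|^{p-2}w=0$ in $\Omega$. Let $u$ be a positive radial strictly monotone decreasing $C^2$-subsolution of this equation. Then at least one of the following alternatives occurs: (i) for every positive (not necessarily radial or decreasing) $C^2$-supersolution $w$ of the equation, there exists $C>0$ with $u(x)\le C\,w(x)$ for all $x\in B[r_0,R_0[$; (ii) for every positive radial strictly monotone decreasing $C^2$-supersolution $v$ of the equation, $u$ is not smaller than $v$, i.e. $$\limsup_{r\to R_0}\frac{u(r)}{v(r)}>0.$$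
   Context: $\Delta_p w=\nabla\cdot(|\nabla w|^{p-2}\nabla w)$. For $0<r_0<R_0\le\infty$, $B]r_0,R_0[=\{x\in\mathbb{R}^N: r_0<|x|<R_0\}$ and $B[r_0,R_0[=\{x\in\mathbb{R}^N: r_0\le|x|<R_0\}$. A $C^2$-subsolution (resp. supersolution) of $-\Delta_p w-V|w|^{p-2}w=0$ in $\Omega=B]r_0,R_0[$ is a function $w\in C^2(B[r_0,R_0[)$ (regular up to the sphere $|x|=r_0$, not necessarily up to $|x|=R_0$) satisfying $-\Delta_p w-V|w|^{p-2}w\le 0$ (resp. $\ge 0$) pointwise in $\Omega$. A radial function $w(x)=\phi(|x|)$ is identified with $\phi$, and $w'(r)=\phi'(r)$; it is strictly monotone decreasing if $w'(r)<0$ for all $r\in[r_0,R_0[$. Condition $( * )$: there exists $\varphi\in C^2(\Omega)$ with $\varphi>0$, $-\Delta_p\varphi-V\varphi^{p-1}\ge 0$ in $\Omega$ and $-\Delta_p\varphi-V\varphi^{p-1}\not\equiv 0$ in $\Omega$. *)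

(* Defs.v *)
From HB Require Import structures.
From mathcomp Require Import all_boot all_order all_algebra.
From mathcomp Require Import all_classical all_reals all_analysis.
Set Implicit Arguments. Unset Strict Implicit. Unset Printing Implicit Defensive.
Import Order.TTheory GRing.Theory Num.Theory.
Import numFieldNormedType.Exports.
Local Open Scope classical_set_scope.
Local Open Scope ring_scope.

Section Defs.
Variables (R : realType) (N : nat).
Notation pt := 'rV[R]_N.

Definition enorm (x : pt) : R := Num.sqrt (\sum_(i < N) x ord0 i ^+ 2).

Definition evec (i : 'I_N) : pt := \row_(j < N) (i == j)%:R.
Definition partial (i : 'I_N) (f : pt -> R) (x : pt) : R := 'D_(evec i) f x.

Definition annulus (r0 : R) (R0 : \bar R) : set pt :=
  [set x | r0 < enorm x /\ ((enorm x)%:E < R0)%E].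
Definition annulus_c (r0 : R) (R0 : \bar R) : set pt :=
  [set x | r0 <= enorm x /\ ((enorm x)%:E < R0)%E].

Definition C2_on (D : set pt) (f : pt -> R) : Prop :=
  forall x, D x ->
    [/\ {for x, continuous f},
        forall i, differentiable f x /\ {for x, continuous (partial i f)},
        forall i, differentiable (partial i f) x &
        forall i j, {for x, continuous (partial j (partial i f))}].

Definition C2_upto (r0 : R) (R0 : \bar R) (f : pt -> R) : Prop :=
  let O := annulus r0 R0 in let Oc := annulus_c r0 R0 in
  [/\ C2_on O f,
      {within Oc, continuous f},
      forall i, exists g : pt -> R, {within Oc, continuous g} /\
                 forall x, O x -> g x = partial i f x &
      forall i j, exists g : pt -> R, {within Oc, continuous g} /\
                 forall x, O x -> g x = partial j (partial i f) x].

Definition gradnorm (f : pt -> R) (x : pt) : R :=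
  Num.sqrt (\sum_(i < N) partial i f x ^+ 2).
Definition plap (p : R) (f : pt -> R) (x : pt) : R :=
  \sum_(i < N) partial i (fun y => powR (gradnorm f y) (p - 2) * partial i f y) x.

Definition Qop (p : R) (V : pt -> R) (f : pt -> R) (x : pt) : R :=
  - plap p f x - V x * (powR `|f x| (p - 2) * f x).

Definition subsolution (p : R) (V : pt -> R) (r0 : R) (R0 : \bar R) (f : pt -> R) :=
  C2_upto r0 R0 f /\ forall x, annulus r0 R0 x -> Qop p V f x <= 0.
Definition supersolution (p : R) (V : pt -> R) (r0 : R) (R0 : \bar R) (f : pt -> R) :=
  C2_upto r0 R0 f /\ forall x, annulus r0 R0 x -> 0 <= Qop p V f x.

Definition positive_on (r0 : R) (R0 : \bar R) (f : pt -> R) :=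
  forall x, annulus_c r0 R0 x -> 0 < f x.

(* radial profile: value of f at a point of norm r *)
Definition profile (f : pt -> R) (r : R) : R :=
  f (const_mx (r / Num.sqrt N%:R)).

Definition radial (r0 : R) (R0 : \bar R) (f : pt -> R) :=
  forall x, annulus_c r0 R0 x -> f x = profile f (enorm x).

Definition strictly_decreasing (r0 : R) (R0 : \bar R) (f : pt -> R) :=
  (forall r, r0 < r -> (r%:E < R0)%E ->
     derivable (profile f) r 1 /\ derive1 (profile f) r < 0) /\
  exists l : R, l < 0 /\
     (fun h => h^-1 * (profile f (r0 + h) - profile f r0)) @ 0^'+ --> l.

Definition cond_star (p : R) (V : pt -> R) (r0 : R) (R0 : \bar R) :=
  exists phi : pt -> R,
    [/\ C2_on (annulus r0 R0) phi,
        forall x, annulus r0 R0 x -> 0 < phi x,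
        forall x, annulus r0 R0 x -> 0 <= - plap p phi x - V x * powR (phi x) (p - 1) &
        exists x, annulus r0 R0 x /\ - plap p phi x - V x * powR (phi x) (p - 1) != 0].

End Defs.

Definition toR0 {R : realType} (R0 : \bar R) : set_system R :=
  match R0 with
  | EFin a => a^'-
  | +oo%E => pinfty_nbhs R
  | -oo%E => ninfty_nbhs R
  end.

(* Main.v *)
(** At a point where the gradient of f is -a n with a > 0 and |n| = 1, and f > 0,
    the equation divided by a^(p-2) becomes
        - (Delta f + (p-2) d^2f/dn^2)  vs.  V F(f, a),   F(z, c) = c (z/c)^(p-1),
    where the left side is linear in f and F is homogeneous and, since p >= 2,
    convex, hence subadditive. So if u, v are radially decreasing sub- and
    supersolutions, z = u - e v satisfies the subsolution inequality wherever
    z > 0 and |u'| > e |v'|. The function Z = z + d (k + z^2), with k >= z^2, is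
    then a strict subsolution, because z' <> 0 and t |-> t + d (k + t^2) is
    strictly convex, so Z cannot touch a multiple of a positive supersolution w
    from below (second derivative test); letting d be small gives a comparison
    principle on shells.

    Suppose u/v is not bounded away from 0 near R0. Comparing u with multiples of
    v (e = 0) shows that u/v is nonincreasing, whence |u'| >= (u/v) |v'|. On the
    shell r0 <= |x| <= t with eta = u(t)/v(t), the comparison of u - e v with C w is
    thus allowed for every e < eta; as e -> eta the boundary value at |x| = t
    vanishes, so C depends only on the sphere |x| = r0, and then eta -> 0. *)

Require Import Defs.
From HB Require Import structures.
From mathcomp Require Import all_boot all_order all_algebra.
From mathcomp Require Import all_classical all_reals all_analysis.
From mathcomp Require Import ring lra.
Import Order.TTheory GRing.Theory Num.Theory.
Import numFieldNormedType.Exports.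
Local Open Scope classical_set_scope.
Local Open Scope ring_scope.

(** * Second-order expansions in one variable and the second derivative test *)

(** The first derivative is carried as a function, so that expansions of sums and products are
    assembled by the usual rules; the second one is recorded at 0 only. *)
Definition jet2 {R : realType} (g g' : R -> R) (g2 : R) : Prop :=
  (\forall t \near 0, is_derive (t : R) 1 g (g' t)) /\ is_derive (0 : R) 1 g' g2.

Lemma jet2D {R : realType} (f g f' g' : R -> R) (f2 g2 : R) :
  jet2 f f' f2 -> jet2 g g' g2 -> jet2 (f + g) (f' + g') (f2 + g2).
Proof.
move=> [f1 df'] [g1 dg']; split; last exact: is_deriveD.
by near=> t; apply: is_deriveD; near: t.
Unshelve. all: by end_near. Qed.

Lemma jet2Z {R : realType} (c : R) (f f' : R -> R) (f2 : R) :
  jet2 f f' f2 -> jet2 (c *: f) (c *: f') (c * f2).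
Proof.
move=> [f1 df']; split; last exact: is_deriveZ.
by near=> t; apply: is_deriveZ; near: t.
Unshelve. all: by end_near. Qed.

Lemma jet2M {R : realType} (f g f' g' : R -> R) (f2 g2 : R) :
  jet2 f f' f2 -> jet2 g g' g2 ->
  jet2 (f * g) (f * g' + g * f')
    (f 0 * g2 + g 0 * f2 + 2 * (f' 0 * g' 0)).
Proof.
move=> [f1 df'] [g1 dg']; split.
  by near=> t; apply: is_deriveM; near: t.
have df := nbhs_singleton f1; have dg := nbhs_singleton g1.
apply: is_derive_eq.
by rewrite /GRing.scale /=; ring.
Unshelve. all: by end_near. Qed.

Lemma jet2_cst {R : realType} (c : R) : jet2 (cst c) (cst 0) 0.
Proof. by split; [near=> t|]; exact: is_derive_cst. Unshelve. all: by end_near. Qed.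

(** The first claim is Fermat's. If [g2 > 0], then [g'] is positive just right of 0, and the mean
    value theorem gives values of [g] above [g 0]. *)
Lemma jet2_max {R : realType} (g g' : R -> R) (g2 : R) :
  jet2 g g' g2 -> (\forall t \near 0, g t <= g 0) -> g' 0 = 0 /\ g2 <= 0.
Proof.
move=> [dg dg'] gmax.
have [e /= e0 He] : exists2 e : R, 0 < e & forall t, `|t| < e ->
    is_derive (t : R) 1 g (g' t) /\ g t <= g 0.
  have /nbhs_ballP[e e0 He] : \forall t \near 0,
      is_derive (t : R) 1 g (g' t) /\ g t <= g 0 by apply: filterI.
  exists e => // t te; apply: He.
  by rewrite /ball /= sub0r normrN.
have He' t : t \in `](- e), e[ -> is_derive (t : R) 1 g (g' t) /\ g t <= g 0.
  by rewrite in_itv /= -ltr_norml; exact: He.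
have g'0 : g' 0 = 0.
  have d0 : is_derive (0 : R) 1 g 0.
    apply: (@derive1_at_max _ g (- e) e) => [||| t /He' []//].
    - by rewrite ltW// gtrN.
    - by move=> t /He'[[]].
    - by rewrite in_itv /= e0 oppr_lt0 e0.
  have e0' : `|0 : R| < e by rewrite normr0.
  have [d1 _] := He 0 e0'.
  by rewrite -(@derive_val _ _ _ _ _ _ _ d1) (@derive_val _ _ _ _ _ _ _ d0).
split => //; rewrite leNgt; apply/negP => g20.
(* Carathéodory's factor: [g' t = h t * t] with [h] continuous at 0 and [h 0 = g2], so [g'] has the
   sign of [t] near 0. *)
have /is_derive1_caratheodory[h [hE hC h0]] := dg'.
have /nbhs_ballP[d /= d0 Hd] : \forall t \near 0, 0 < h t.
  by apply: (cvgr_gt _ hC); rewrite h0.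
pose m := Num.min e d / 2.
have m0 : 0 < m by rewrite divr_gt0// lt_min e0 d0.
have me : m < e by rewrite ltr_pdivrMr// gt_min ltr_pMr// ltr1n.
have md : m < d by rewrite ltr_pdivrMr// gt_min (ltr_pMr _ d0) ltr1n orbT.
have Hm t : t \in `[0, m] -> is_derive (t : R) 1 g (g' t) /\ g t <= g 0.
  rewrite in_itv /= => /andP[t0 tm]; apply: He.
  by rewrite ger0_norm// (le_lt_trans tm).
have [||t + ] := @MVT _ g g' 0 m m0.
- by move=> t tm; have [] := Hm t (subset_itv_oo_cc tm).
- apply: derivable_within_continuous => t tm; have [dt _] := Hm t tm; exact: ex_derive.
rewrite in_itv /= => /andP[t0 tm] gE.
have itv_m : m \in `[0, m] by rewrite in_itv /= lexx ltW.
have ht : 0 < h t by apply: Hd; rewrite /ball /= sub0r normrN gtr0_norm// (lt_trans tm).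
have := hE t; rewrite g'0 !subr0 => g'E.
have [_] := Hm m (itv_m).
rewrite leNgt => /negP; apply; rewrite -subr_gt0 gE g'E subr0; apply: mulr_gt0 => //; exact: mulr_gt0.
Qed.

(** * Restriction to lines, Hessians and the expanded p-Laplacian *)

#[local] Instance is_diff_line {R : realType} {N : nat} (x d : 'rV[R]_N) (t : R) :
  is_diff t (fun s : R => x + s *: d) ( *:%R ^~ d).
Proof.
have := @is_diffD R R 'rV[R]_N (cst x) ( *:%R ^~ d) 0 ( *:%R ^~ d) t _ _.
by rewrite add0r; apply.
Qed.

Lemma near_line {R : realType} {N : nat} (x d : 'rV[R]_N) (P : set 'rV[R]_N) :
  (\forall y \near x, P y) -> \forall t \near (0 : R), P (x + t *: d).
Proof.
have /differentiable_continuous : differentiable (fun s : R => x + s *: d) 0.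
  by apply: ex_diff.
by move=> /(_ P); rewrite /= scale0r addr0; apply.
Qed.

Lemma is_derive_line {R : realType} {N : nat} (f : 'rV[R]_N -> R)
    (x d : 'rV[R]_N) (t : R) :
  differentiable f (x + t *: d) ->
  is_derive t 1 (fun s : R => f (x + s *: d))
    (\sum_i d ord0 i * partial i f (x + t *: d)).
Proof.
move=> df.
pose l := fun s : R => x + s *: d.
have dl : is_diff t l ( *:%R ^~ d) by exact: is_diff_line.
have dfl : differentiable (f \o l) t by apply: differentiable_comp.
have -> : (fun s : R => f (x + s *: d)) = f \o l by [].
apply: DeriveDef; first exact/derivable1_diffP.
rewrite deriveE// diff_comp//= diff_val scale1r.
rewrite [in LHS](_ : d = \sum_i d ord0 i *: evec R i); last first.
  apply/rowP => j; rewrite summxE (bigD1 j)//= !mxE eqxx mulr1.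
  rewrite big1 ?addr0// => i ij; by rewrite !mxE (negbTE ij) mulr0.
rewrite linear_sum; apply: eq_bigr => i _.
by rewrite linearZ /= /partial deriveE.
Qed.

Definition diff2_at {R : realType} {N : nat} (f : 'rV[R]_N -> R) (x : 'rV[R]_N) :=
  (\forall y \near x, differentiable f y) /\
  forall i, differentiable (partial i f) x.

Definition hess {R : realType} {N : nat} (f : 'rV[R]_N -> R) (x d : 'rV[R]_N) : R :=
  \sum_i \sum_j d ord0 i * d ord0 j * partial j (partial i f) x.

Lemma diff2_at_jet2 {R : realType} {N : nat} (f : 'rV[R]_N -> R) (x d : 'rV[R]_N) :
  diff2_at f x ->
  jet2 (fun t => f (x + t *: d))
    (fun t => \sum_i d ord0 i * partial i f (x + t *: d)) (hess f x d).
Proof.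
move=> [df dpf]; split.
  have Hl := near_line x d _ df.
  by near=> t; apply: is_derive_line; near: t.
rewrite /hess.
have -> : (fun t => \sum_i d ord0 i * partial i f (x + t *: d)) =
   \sum_i (fun t => d ord0 i * partial i f (x + t *: d)).
  by apply/funext => t; rewrite fct_sumE.
apply: is_derive_sum => i.
have /is_derive_line dl : differentiable (partial i f) (x + (0:R) *: d).
  by rewrite scale0r addr0.
have := @is_deriveZ _ _ _ _ (d ord0 i) _ _ _ dl.
rewrite scale0r addr0 => ?; apply: is_derive_eq.
by rewrite scaler_sumr; apply: eq_bigr => j _; rewrite /GRing.scale /= mulrA.
Unshelve. all: by end_near. Qed.

(** Both sides are limits of the same difference quotient; the one-variable product and chain rules
    thus apply to [partial]. *)
Lemma derive_line {R : realType} {N : nat} (f : 'rV[R]_N -> R)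
    (x d : 'rV[R]_N) : 'D_d f x = 'D_1 (fun t : R => f (x + t *: d)) 0.
Proof.
rewrite /derive; set g1 := fun h => h^-1 *: _; set g2 := fun h => h^-1 *: _.
suff -> : g1 = g2 by []; apply/funext => h; rewrite /g1 /g2 /=.
by rewrite scale0r !addr0 [_%:A]mulr1 (addrC x).
Qed.

Lemma is_derive_line0 {R : realType} {N : nat} (f : 'rV[R]_N -> R)
    (x d : 'rV[R]_N) :
  differentiable f x ->
  is_derive (0 : R) 1 (fun s : R => f (x + s *: d)) ('D_d f x).
Proof.
move=> df; rewrite derive_line; apply: (@derivableP R R R).
have /is_derive_line[] // : differentiable f (x + (0 : R) *: d).
by rewrite scale0r addr0.
Qed.

Fact plapE_field {R : realType} (p a s A B c : R) : a != 0 ->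
  A * B + - (a * c) * ((p - 2) * (A / a) * ((2 * a)^-1 * (- (2 * a) * s))) =
  A * B + A * ((p - 2) * (c * s)).
Proof. by move=> a0; field. Qed.

(** By the chain rule the i-th derivative of [|grad f|^(p-2)] is [(p-2) a^(p-2) / a] times
    [- \sum_j n_j d_i d_j f]; [a > 0] keeps root and power differentiable. *)
Lemma plapE {R : realType} {N : nat} (p a : R) (f : 'rV[R]_N -> R)
    (x n : 'rV[R]_N) :
  diff2_at f x -> 0 < a -> \sum_i n ord0 i ^+ 2 = 1 ->
  (forall i, partial i f x = - (a * n ord0 i)) ->
  plap p f x =
    a `^ (p - 2) *
    (\sum_i partial i (partial i f) x + (p - 2) * hess f x n).
Proof.
move=> [_ df] a0 n1 fn.
have gradE : \sum_j partial j f x ^+ 2 = a ^+ 2.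
  rewrite (eq_bigr (fun j => a ^+ 2 * n ord0 j ^+ 2)) -?mulr_sumr ?n1 ?mulr1//.
  by move=> j _; rewrite fn; ring.
have a20 : 0 < a ^+ 2 by rewrite exprn_gt0.
rewrite /plap.
transitivity (\sum_i (a `^ (p - 2) * partial i (partial i f) x +
   a `^ (p - 2) * ((p - 2) * (\sum_j n ord0 i * n ord0 j * partial i (partial j f) x)))).
  apply: eq_bigr => i _.
  rewrite {1}/partial derive_line; apply: derive_val.
  pose q j := fun t : R => partial j f (x + t *: evec R i).
  have dq j : is_derive (0 : R) 1 (q j) (partial i (partial j f) x).
    exact: is_derive_line0.
  have q0 j : q j 0 = - (a * n ord0 j) by rewrite /q scale0r addr0.
  have dS : is_derive (0 : R) 1 (\sum_j (q j ^+ 2))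
      (\sum_j (2 * q j 0 * partial i (partial j f) x)).
    by apply: is_derive_sum => j; apply: is_derive_eq.
  have S0 : (\sum_j (q j ^+ 2)) 0 = a ^+ 2.
    rewrite fct_sumE -gradE; apply: eq_bigr => j _.
    by rewrite -[LHS]/(q j 0 ^+ 2) /q scale0r addr0.
  have dsq : is_derive ((\sum_j (q j ^+ 2)) 0) 1 Num.sqrt (2 * a)^-1.
    rewrite S0; have := @is_derive1_sqrt _ _ a20.
    by rewrite sqrtr_sqr gtr0_norm.
  have sq0 : Num.sqrt ((\sum_j (q j ^+ 2)) 0) = a.
    by rewrite S0 sqrtr_sqr gtr0_norm.
  have dG := is_derive1_comp dsq dS.
  have dpw : is_derive ((Num.sqrt \o (\sum_j (q j ^+ 2))) 0) 1
      (@powR R ^~ (p - 2)) ((p - 2) * a `^ (p - 2 - 1)).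
    by rewrite /= sq0; exact: is_derive1_powR.
  have dP := is_derive1_comp dpw dG.
  have := is_deriveM dP (dq i).
  rewrite [X in is_derive _ _ X _ -> _](_ : _ =
     (fun t : R => gradnorm f (x + t *: evec R i) `^ (p - 2) *
         partial i f (x + t *: evec R i))); last first.
    apply/funext => t; rewrite /= /gradnorm /GRing.mul /=.
    congr (Num.sqrt _ `^ _ * _); rewrite fct_sumE; apply: eq_bigr => j _.
    by rewrite /q.
  move=> dall; apply: is_derive_eq.
  rewrite /= sq0 q0 /GRing.scale /=.
  rewrite (eq_bigr (fun j => - (2 * a) * (n ord0 j * partial i (partial j f) x))); last first.
    by move=> j _; rewrite q0; ring.
  rewrite -mulr_sumr.
  rewrite [in RHS](eq_bigr (fun j => n ord0 i * (n ord0 j * partial i (partial j f) x))); last first.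
    by move=> j _; rewrite mulrA.
  rewrite -mulr_sumr.
  have an0 : a != 0 by rewrite gt_eqF.
  have -> : a `^ (p - 2 - 1) = a `^ (p - 2) / a.
    by rewrite powRD ?an0 ?implybT// powRN powRr1// ltW.
  exact: plapE_field.
rewrite big_split /= mulrDr mulr_sumr; congr (_ + _).
(* Exchanging the two sums matches the order of the mixed derivatives. *)
rewrite /hess exchange_big /= mulr_sumr mulr_sumr; apply: eq_bigr => i _.
congr (_ * (_ * _)); apply: eq_bigr => j _.
by rewrite [n _ _ * n _ _]mulrC.
Qed.

(** * The zero-order term after division by [a^(p-2)] *)

(** The [F] of the overview: the perspective of the power [t^(p-1)], equal to [z^(p-1) / c^(p-2)]
    for [z >= 0] and [c > 0]. *)
Definition persp {R : realType} (p z c : R) : R := c * (z / c) `^ (p - 1).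

Lemma persp_homog {R : realType} (p m z c : R) :
  m != 0 -> persp p (m * z) (m * c) = m * persp p z c.
Proof. by move=> m0; rewrite /persp -mulf_div divff// mul1r mulrA. Qed.

Lemma persp_le {R : realType} (p z z' c : R) :
  1 <= p -> 0 <= z -> z <= z' -> 0 < c -> persp p z c <= persp p z' c.
Proof.
move=> p1 z0 zz' c0; rewrite /persp ler_pM2l//.
apply: ge0_ler_powR; rewrite ?nnegrE ?subr_ge0//.
- by rewrite divr_ge0// ltW.
- by apply: divr_ge0; [exact: le_trans zz'|exact: ltW].
- by rewrite ler_pM2r// invr_gt0.
Qed.

(** [(z + y) / (c + b)] is the convex combination of [z / c] and [y / b] with weights [c / (c + b)]
    and [b / (c + b)], and [t^(p-1)] is convex. *)
Lemma persp_subadditive {R : realType} (p z c y b : R) :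
  2 <= p -> 0 <= z -> 0 < c -> 0 <= y -> 0 < b ->
  persp p (z + y) (c + b) <= persp p z c + persp p y b.
Proof.
move=> p2 z0 c0 y0 b0.
have cb0 : 0 < c + b by rewrite addr_gt0.
have cbn := lt0r_neq0 cb0; have cn := lt0r_neq0 c0; have bn := lt0r_neq0 b0.
have t0 : 0 <= c / (c + b) by rewrite divr_ge0 ?ltW.
have t1 : c / (c + b) <= 1 by rewrite ler_pdivrMr// mul1r lerDl ltW.
have p1 : 1 <= p - 1 by lra.
have := @convex_powR R (p - 1) p1 (Itv01 t0 t1) (z / c) (y / b).
have zc0 : 0 <= z / c by apply: divr_ge0 => //; exact: ltW.
have yb0 : 0 <= y / b by apply: divr_ge0 => //; exact: ltW.
rewrite !inE /= !in_itv /= !andbT zc0 yb0 => /(_ isT isT).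
rewrite !convRE /= /unstable.onem.
rewrite [X in X `^ _ <= _]convRE /= /unstable.onem.
rewrite [X in X `^ _ <= _](_ : _ = (z + y) / (c + b)); last by field; apply/and3P.
rewrite /persp -(ler_pM2l cb0) => /le_trans; apply.
rewrite le_eqVlt; apply/orP; left; apply/eqP.
move: (_ `^ _) (_ `^ _) => A B.
by field.
Qed.

(** Subadditivity for [u = (u - e v) + e v] and [a = (a - e b) + e b], then homogeneity, which
    requires a nonzero factor; hence the separate case [e = 0]. *)
Lemma persp_sub_le {R : realType} (p u a v b e : R) :
  2 <= p -> 0 <= e -> 0 < v -> 0 < b -> 0 < u - e * v -> 0 < a - e * b ->
  persp p u a - e * persp p v b <= persp p (u - e * v) (a - e * b).
Proof.
move=> p2 e0 v0 b0 uv ab.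
have [->|en] := eqVneq e 0; first by rewrite !mul0r !subr0.
have ep : 0 < e by rewrite lt_def en.
rewrite lerBlDr -persp_homog//.
have := @persp_subadditive R p _ _ (e * v) (e * b) p2 (ltW uv) ab.
by rewrite !subrK; apply; rewrite ?ltW ?mulr_gt0.
Qed.

Definition lin_op {R : realType} {N : nat} (p : R) (f : 'rV[R]_N -> R)
    (x n : 'rV[R]_N) : R :=
  \sum_i partial i (partial i f) x + (p - 2) * hess f x n.

Lemma Qop_lin_op {R : realType} {N : nat} (p a : R) (V f : 'rV[R]_N -> R)
    (x n : 'rV[R]_N) :
  diff2_at f x -> 0 < a -> \sum_i n ord0 i ^+ 2 = 1 ->
  (forall i, partial i f x = - (a * n ord0 i)) -> 0 < f x ->
  Qop p V f x = - (a `^ (p - 2) * (lin_op p f x n + V x * persp p (f x) a)).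
Proof.
move=> f2 a0 n1 fn fx0; rewrite /Qop (@plapE _ _ _ a _ _ n)// -/(lin_op p f x n).
rewrite [in RHS]mulrDr [RHS]opprD; congr (_ + _); congr (- _).
rewrite gtr0_norm// [RHS]mulrCA; congr (_ * _).
rewrite /persp mulrA -[X in _ `^ _ * X * _](powRr1 (ltW a0)).
rewrite -powRD ?(gt_eqF a0) ?implybT//.
rewrite (_ : p - 2 + 1 = p - 1); last by ring.
rewrite -powRM ?divr_ge0 ?ltW// mulrCA mulfV ?gt_eqF// mulr1.
rewrite -[X in _ `^ _ * X](powRr1 (ltW fx0)) -powRD ?(gt_eqF fx0) ?implybT//.
by congr (_ `^ _); ring.
Qed.

Lemma hess_evec {R : realType} {N : nat} (f : 'rV[R]_N -> R) (x : 'rV[R]_N) i :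
  hess f x (evec R i) = partial i (partial i f) x.
Proof.
rewrite /hess (bigD1 i)//= [X in _ + X]big1 ?addr0; last first.
  by move=> j ji; apply: big1 => k _; rewrite !mxE eq_sym (negbTE ji) !mul0r.
rewrite (bigD1 i)//= [X in _ + X]big1 ?addr0; last first.
  by move=> j ji; rewrite !mxE (eq_sym i j) (negbTE ji) mulr0 mul0r.
by rewrite !mxE eqxx !mul1r.
Qed.

(** * Impossibility of touching *)

Definition dird {R : realType} {N : nat} (f : 'rV[R]_N -> R) (x d : 'rV[R]_N) : R :=
  \sum_i d ord0 i * partial i f x.

(** The second derivative test along the line through [x] in direction [d]. The square on the left
    is the part of [(z^2)''] that makes the inequality strict later. *)
Lemma contact_line {R : realType} {N : nat} (u v w : 'rV[R]_N -> R)
    (x d : 'rV[R]_N) (e dl k m : R) :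
  diff2_at u x -> diff2_at v x -> diff2_at w x ->
  let z y := u y - e * v y in
  (\forall y \near x, z y + dl * (k + z y ^+ 2) - m * w y <=
                      z x + dl * (k + z x ^+ 2) - m * w x) ->
  (1 + 2 * dl * z x) * (dird u x d - e * dird v x d) = m * dird w x d /\
  (1 + 2 * dl * z x) * (hess u x d - e * hess v x d) +
    2 * dl * (dird u x d - e * dird v x d) ^+ 2 <= m * hess w x d.
Proof.
move=> u2 v2 w2 z zmax.
have ju := diff2_at_jet2 _ _ d u2.
have jz := jet2D _ _ _ _ _ _ ju (jet2Z (- e) _ _ _ (diff2_at_jet2 _ _ d v2)).
have jk := jet2D _ _ _ _ _ _ (jet2_cst k) (jet2M _ _ _ _ _ _ jz jz).
have jG := jet2D _ _ _ _ _ _ (jet2D _ _ _ _ _ _ jz (jet2Z dl _ _ _ jk))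
  (jet2Z (- m) _ _ _ (diff2_at_jet2 _ _ d w2)).
have x0 : x + (0 : R) *: d = x by rewrite scale0r addr0.
have [|] := jet2_max _ _ _ jG.
  have := near_line x d _ zmax; apply: filterS => t /=.
  rewrite !fctE /= x0 /z /GRing.scale /=.
  by rewrite !mulNr !expr2.
rewrite !fctE /= x0 /GRing.scale /= => H1 H2.
rewrite /dird /z; split.
  apply/eqP; rewrite -subr_eq0; apply/eqP; apply: etrans H1; ring.
rewrite -subr_le0; apply: le_trans H2; rewrite le_eqVlt; apply/orP; left; apply/eqP.
move: (hess u x d) (hess v x d) (hess w x d) => hu hv hw.
move: (\sum_(i < N) d ord0 i * partial i u x) (\sum_(i < N) d ord0 i * partial i v x) => su sv.
move: (u x) (v x) => ux vx. clear.
ring.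
Qed.

Lemma dird_evec {R : realType} {N : nat} (f : 'rV[R]_N -> R) (x : 'rV[R]_N) i :
  dird f x (evec R i) = partial i f x.
Proof.
rewrite /dird (bigD1 i)//= big1 ?addr0 ?mxE ?eqxx ?mul1r// => j ji.
by rewrite mxE eq_sym (negbTE ji) mul0r.
Qed.

Lemma dird_normal {R : realType} {N : nat} (a : R) (f : 'rV[R]_N -> R)
    (x n : 'rV[R]_N) :
  \sum_i n ord0 i ^+ 2 = 1 -> (forall i, partial i f x = - (a * n ord0 i)) ->
  dird f x n = - a.
Proof.
move=> n1 fn; rewrite /dird -[RHS]mulr1 -n1 mulr_sumr.
by apply: eq_bigr => i _; rewrite fn; ring.
Qed.

(** Adds the inequality for the Laplacian and [q - 2] times the one for direction [n]; the gains [D]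
    add up to [1 + (q - 2)] of them. *)
Lemma weighted_sum_le {R : realType} (q F e m D su sv sw hu hv hw : R) :
  0 <= q - 2 ->
  F * (su - e * sv) + D <= m * sw -> F * (hu - e * hv) + D <= m * hw ->
  F * (su + (q - 2) * hu - e * (sv + (q - 2) * hv)) + (q - 1) * D <=
  m * (sw + (q - 2) * hw).
Proof. by move=> q0 Hs Hh; have := ler_wpM2l q0 Hh; lra. Qed.

(** At a contact point the gradients of [z] and [w] are parallel, so all three equations linearise
    with the same [n]. Together they contradict the strict gain from [z^2]. *)
Lemma no_contact {R : realType} {N : nat} (p a b e dl k m : R)
    (V u v w : 'rV[R]_N -> R) (x n : 'rV[R]_N) :
  2 <= p -> diff2_at u x -> diff2_at v x -> diff2_at w x ->
  \sum_i n ord0 i ^+ 2 = 1 ->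
  (forall i, partial i u x = - (a * n ord0 i)) ->
  (forall i, partial i v x = - (b * n ord0 i)) ->
  0 < b -> 0 <= e -> e * b < a -> 0 < v x -> e * v x < u x -> 0 < w x ->
  0 <= V x -> Qop p V u x <= 0 -> 0 <= Qop p V v x -> 0 <= Qop p V w x ->
  0 < dl -> 0 < m ->
  let z y := u y - e * v y in
  z x ^+ 2 <= k ->
  z x + dl * (k + z x ^+ 2) = m * w x ->
  ~ \forall y \near x, z y + dl * (k + z y ^+ 2) <= m * w y.
Proof.
move=> p2 u2 v2 w2 n1 un vn b0 e0 ab v0 uv w0 V0 Qu Qv Qw dl0 m0 z zk zmw zmax.
have c0 : 0 < a - e * b by rewrite subr_gt0.
have z0 : 0 < z x by rewrite subr_gt0.
have a0 : 0 < a by apply: le_lt_trans ab; rewrite mulr_ge0// ltW.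
have u0 : 0 < u x by apply: le_lt_trans uv; rewrite mulr_ge0// ltW.
(* [F'] is the derivative of [t |-> t + dl * (k + t^2)] at [z x], kept opaque for the algebra
   below. *)
have [F' F'E] : exists F', F' = 1 + 2 * dl * z x by exists (1 + 2 * dl * z x).
have F0 : 0 < F' by rewrite F'E addr_gt0// !mulr_gt0.
have mn := lt0r_neq0 m0.
have cl d := @contact_line _ _ u v w x d e dl k m u2 v2 w2.
have {}cl d : F' * (dird u x d - e * dird v x d) = m * dird w x d /\
    F' * (hess u x d - e * hess v x d) +
    2 * dl * (dird u x d - e * dird v x d) ^+ 2 <= m * hess w x d.
  rewrite F'E; apply: cl; rewrite -/(z x) zmw subrr.
  by apply: filterS zmax => y; rewrite subr_le0.
have wn i : partial i w x = - (F' * (a - e * b) / m * n ord0 i).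
  have [H _] := cl (evec R i); rewrite !dird_evec un vn in H.
  by apply: (mulfI mn); rewrite -H; field.
have aw0 : 0 < F' * (a - e * b) / m by rewrite divr_gt0// mulr_gt0.
have Lu : 0 <= lin_op p u x n + V x * persp p (u x) a.
  by move: Qu; rewrite (@Qop_lin_op _ _ _ a _ _ _ n)// oppr_le0 pmulr_rge0 ?powR_gt0.
have Lv : lin_op p v x n + V x * persp p (v x) b <= 0.
  by move: Qv; rewrite (@Qop_lin_op _ _ _ b _ _ _ n)// oppr_ge0 pmulr_rle0 ?powR_gt0.
have Lw : lin_op p w x n + V x * persp p (w x) (F' * (a - e * b) / m) <= 0.
  by move: Qw; rewrite (@Qop_lin_op _ _ _ (F' * (a - e * b) / m) _ _ _ n)// oppr_ge0 pmulr_rle0 ?powR_gt0.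
(* The coordinate directions are summed; the gains carry weights [n_i^2], which add up to 1. *)
have S1 : F' * (\sum_i partial i (partial i u) x - e * \sum_i partial i (partial i v) x)
    + 2 * dl * (a - e * b) ^+ 2 <= m * \sum_i partial i (partial i w) x.
  rewrite -[X in _ * X ^+ 2]mulr1 exprMn expr1n -[X in _ * (_ * X)]n1.
  rewrite !mulr_sumr -sumrB !mulr_sumr -big_split /=; apply: ler_sum => i _.
  have [_] := cl (evec R i); rewrite !dird_evec !hess_evec un vn.
  move: (partial i (partial i u) x) (partial i (partial i v) x)
    (partial i (partial i w) x) (n _ _) => pu pv pw ni H.
  by apply: le_trans H; clear; rewrite le_eqVlt; apply/orP; left; apply/eqP; ring.
have S2 : F' * (hess u x n - e * hess v x n) + 2 * dl * (a - e * b) ^+ 2 <= m * hess w x n.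
  have [_] := cl n; rewrite (dird_normal a)// (dird_normal b)//.
  move: (hess u x n) (hess v x n) (hess w x n) => hu hv hw H.
  by apply: le_trans H; clear; rewrite le_eqVlt; apply/orP; left; apply/eqP; ring.
have S : F' * (lin_op p u x n - e * lin_op p v x n) + (p - 1) * (2 * dl * (a - e * b) ^+ 2)
    <= m * lin_op p w x n.
  have p20 : 0 <= p - 2 by rewrite subr_ge0.
  exact: weighted_sum_le S1 S2.
have P1 : persp p (u x) a - e * persp p (v x) b <= persp p (z x) (a - e * b).
  exact: persp_sub_le.
(* By homogeneity [F'] moves inside, and [F' z = z + 2 dl z^2 <= z + dl (k + z^2) = m w] because
   [z^2 <= k]. *)
have P2 : F' * persp p (z x) (a - e * b) <= m * persp p (w x) (F' * (a - e * b) / m).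
  rewrite -persp_homog ?gt_eqF// -persp_homog// -zmw.
  rewrite (_ : m * (F' * (a - e * b) / m) = F' * (a - e * b)); last by field.
  apply: persp_le; [by clear -p2; lra|by rewrite mulr_ge0 ?ltW| |exact: mulr_gt0].
  have : dl * z x ^+ 2 <= dl * k by rewrite ler_pM2l.
  rewrite F'E; move: (z x) => t; clear; lra.
have T : 0 < (p - 1) * (2 * dl * (a - e * b) ^+ 2).
  rewrite mulr_gt0 ?mulr_gt0 ?exprn_gt0//; clear -p2; lra.
have A1 : 0 <= F' * ((lin_op p u x n + V x * persp p (u x) a) -
    e * (lin_op p v x n + V x * persp p (v x) b)).
  apply: mulr_ge0; first exact: ltW.
  by rewrite subr_ge0 (le_trans _ Lu)// mulr_ge0_le0.
have A2 := ler_wpM2l V0 P2.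
have A3 := ler_wpM2l V0 (ler_wpM2l (ltW F0) P1).
have A4 : m * (lin_op p w x n + V x * persp p (w x) (F' * (a - e * b) / m)) <= 0.
  by rewrite pmulr_rle0.
move: A1 A2 A3 A4 S T.
move: (persp p (u x) a) (persp p (v x) b) (persp p (w x) _) (persp p (z x) _).
move: (lin_op p u x n) (lin_op p v x n) (lin_op p w x n) ((p - 1) * _).
by clear; move=> *; lra.
Qed.

(** * Euclidean norm, shells and gradients of radial functions *)

Lemma enorm_ge0 {R : realType} {N : nat} (x : 'rV[R]_N) : 0 <= enorm x.
Proof. exact: sqrtr_ge0. Qed.

Lemma sqr_enorm {R : realType} {N : nat} (x : 'rV[R]_N) :
  enorm x ^+ 2 = \sum_i x ord0 i ^+ 2.
Proof. by rewrite sqr_sqrtr// sumr_ge0// => i _; rewrite sqr_ge0. Qed.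

Lemma enorm_continuous {R : realType} {N : nat} :
  continuous (@enorm R N).
Proof.
move=> x; apply: continuous_comp; last exact: sqrt_continuous.
rewrite (_ : (fun x => _) = \sum_(i < N) (fun x : 'rV[R]_N => x ord0 i ^+ 2)); last first.
  by apply/funext => y; rewrite fct_sumE.
apply: differentiable_continuous; apply: differentiable_sum => i.
have := @differentiable_coord R 1 N x ord0 i.
by move=> /(@differentiableX _ _ _ 1 _).
Qed.

(** The library norm on row vectors is the maximum norm, which [enorm] dominates, so the shell is
    bounded; it is closed as a preimage. *)
Lemma compact_shell {R : realType} {N : nat} (s t : R) :
  compact [set x : 'rV[R]_N | s <= enorm x <= t].
Proof.
apply: bounded_closed_compact.
  exists t; split; first exact: num_real.
  move=> M tM x /= /andP[_ xt]; rewrite [leLHS]/Num.norm /= mx_normrE.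
  apply/bigmax_leP; split => [|[i j] _ /=].
    by rewrite (le_trans (enorm_ge0 x))// (le_trans xt)// ltW.
  rewrite (le_trans _ (ltW tM))// (le_trans _ xt)// ord1.
  rewrite -ler_sqr ?nnegrE ?enorm_ge0// sqr_enorm real_normK ?num_real//.
  by rewrite (bigD1 j)//= lerDl sumr_ge0// => k _; rewrite sqr_ge0.
rewrite (_ : [set _ | _] = @enorm R N @^-1` `[s, t]%classic); last first.
  by apply/seteqP; split => x /=; rewrite in_itv.
apply: preimage_closed; last exact: itv_closed.
by move=> x _; exact: enorm_continuous.
Qed.

Lemma near_annulus {R : realType} {N : nat} (r0 : R) (R0 : \bar R) (x : 'rV[R]_N) :
  annulus r0 R0 x -> \forall y \near x, annulus r0 R0 y.
Proof.
case=> r0x xR0; near=> y; split; near: y.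
  by apply: (cvgr_gt _ (enorm_continuous x)).
case: R0 xR0 => [t|_|//].
  rewrite lte_fin => xt.
  near=> y; rewrite lte_fin; near: y.
  by apply: (cvgr_lt _ (enorm_continuous x)).
by apply: nearW => y; rewrite ltry.
Unshelve. all: by end_near. Qed.

(** [C2_on] states differentiability of [f] under a quantifier over indices, so [0 < N] supplies
    one. *)
Lemma C2_on_diff2_at {R : realType} {N : nat} (r0 : R) (R0 : \bar R)
    (f : 'rV[R]_N -> R) (x : 'rV[R]_N) :
  (0 < N)%N -> C2_on (annulus r0 R0) f -> annulus r0 R0 x -> diff2_at f x.
Proof.
move=> N0 Cf Ax; split; last by have [_ _ ] := Cf x Ax.
apply: filterS (near_annulus _ _ _ Ax) => y Ay.
by have [_ /(_ (Ordinal N0))[]] := Cf y Ay.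
Qed.

Lemma enorm_const_mx {R : realType} {N : nat} (r : R) :
  (0 < N)%N -> 0 <= r ->
  enorm (const_mx (r / Num.sqrt N%:R) : 'rV[R]_N) = r.
Proof.
move=> N0 r_ge0; apply/eqP; rewrite -(@eqrXn2 _ 2) ?enorm_ge0//.
rewrite sqr_enorm (eq_bigr (fun=> (r / Num.sqrt N%:R) ^+ 2)); last first.
  by move=> i _; rewrite mxE.
rewrite sumr_const card_ord expr_div_n sqr_sqrtr ?ler0n//.
by rewrite -[_ *+ N]mulr_natr divfK// pnatr_eq0 -lt0n.
Qed.

(** Along a coordinate line [enorm] is the root of a quadratic polynomial, and [f] is its profile
    composed with it throughout a neighbourhood. *)
Lemma radial_gradient {R : realType} {N : nat} (r0 : R) (R0 : \bar R)
    (f : 'rV[R]_N -> R) (x : 'rV[R]_N) :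
  0 <= r0 -> radial r0 R0 f -> annulus r0 R0 x ->
  derivable (profile f) (enorm x) 1 ->
  forall i, partial i f x = derive1 (profile f) (enorm x) * (x ord0 i / enorm x).
Proof.
move=> r00 rf Ax df i; rewrite /partial derive_line; apply: derive_val.
have x0 : 0 < enorm x by case: Ax => /(le_lt_trans r00).
have x20 : 0 < enorm x ^+ 2 by rewrite exprn_gt0.
pose q := (fun=> enorm x ^+ 2) + 2 * x ord0 i *: id + (id : R -> R) ^+ 2.
have dq : is_derive (0 : R) 1 q (2 * x ord0 i).
  apply: is_derive_eq; rewrite /GRing.scale /=; ring.
have q0 : q 0 = enorm x ^+ 2.
  rewrite /q !fctE /= /GRing.scale /=; ring.
have qE t : enorm (x + t *: evec R i) = Num.sqrt (q t).
  congr Num.sqrt; rewrite /q !fctE /= /GRing.scale /= sqr_enorm.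
  rewrite (bigD1 i)//= [in RHS](bigD1 i)//= !mxE eqxx mulr1.
  rewrite (eq_bigr (fun j => x ord0 j ^+ 2)); last first.
    by move=> j ji; rewrite !mxE eq_sym (negbTE ji) mulr0 addr0.
  move: (\sum_(j < N | j != i) _) => s; ring.
have sq : Num.sqrt (q 0) = enorm x by rewrite q0 sqrtr_sqr gtr0_norm.
have ds : is_derive (q 0) 1 Num.sqrt (2 * enorm x)^-1.
  by rewrite -[in (2 * _)]sq; apply: is_derive1_sqrt; rewrite q0.
have dsq := is_derive1_comp ds dq.
have dp : is_derive ((Num.sqrt \o q) 0) 1 (profile f) (derive1 (profile f) (enorm x)).
  by rewrite /= sq derive1E; exact: derivableP.
have d := is_derive1_comp dp dsq.
apply: near_eq_is_derive (is_derive_eq d _); last first.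
  by field; rewrite gt_eqF.
have := near_line x (evec R i) _ (near_annulus _ _ _ Ax).
apply: filterS => t [At1 At2]; rewrite /= -qE rf//.
by split => //; exact: ltW.
Qed.

(** * Comparison on compact shells *)

Lemma shell_lower_bound {R : realType} {N : nat} (s t : R) (w : 'rV[R]_N -> R) :
  {within [set x | s <= enorm x <= t], continuous w} ->
  (forall x, s <= enorm x <= t -> 0 < w x) ->
  exists2 m : R, 0 < m & forall x, s <= enorm x <= t -> m <= w x.
Proof.
move=> cw w0.
have [A0|/set0P A0] := eqVneq [set x : 'rV[R]_N | s <= enorm x <= t] set0.
  exists 1 => // x xA; have : [set x : 'rV[R]_N | s <= enorm x <= t] x by [].
  by rewrite A0.
have [c /set_mem cA cmin] := EVT_min_rV A0 (compact_shell s t) cw.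
by exists (w c) => [|x xA]; [exact: w0|apply: cmin; exact/mem_set].
Qed.

Lemma shell_sub {R : realType} {N : nat} (r0 s t : R) (R0 : \bar R) :
  r0 <= s -> (t%:E < R0)%E ->
  [set x : 'rV[R]_N | s <= enorm x <= t] `<=` annulus_c r0 R0.
Proof.
move=> rs tR x /= /andP[sx xt]; split; first exact: le_trans sx.
by apply: le_lt_trans tR; rewrite lee_fin.
Qed.

(** If the bound failed, the maximum [m] of [Z / w] on the shell would exceed [C]. The slack [g]
    keeps its maximiser off the boundary, so [m w] touches [Z] from above at an interior point,
    against [no_contact]. *)
Lemma shell_comparison {R : realType} {N : nat} (p r0 : R) (R0 : \bar R)
    (V u v w : 'rV[R]_N -> R) (e C g s t : R) :
  (0 < N)%N -> 2 <= p -> 0 < r0 ->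
  (forall x, annulus r0 R0 x -> 0 <= V x) ->
  [/\ positive_on r0 R0 u, radial r0 R0 u, strictly_decreasing r0 R0 u &
      subsolution p V r0 R0 u] ->
  [/\ positive_on r0 R0 v, radial r0 R0 v, strictly_decreasing r0 R0 v &
      supersolution p V r0 R0 v] ->
  positive_on r0 R0 w -> supersolution p V r0 R0 w ->
  r0 <= s -> (t%:E < R0)%E -> 0 <= e -> 0 < C -> 0 < g ->
  (forall x, s < enorm x < t -> e * v x < u x /\
     derive1 (profile u) (enorm x) < e * derive1 (profile v) (enorm x)) ->
  (forall x, enorm x = s \/ enorm x = t -> s <= enorm x <= t ->
    u x - e * v x + g <= C * w x) ->
  forall x, s <= enorm x <= t -> u x - e * v x <= C * w x.
Proof.
move=> N0 p2 r00 V0 [u0 ru du [[Cu cu _ _] Qu]] [v0 rv dv [[Cv cv _ _] Qv]].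
move=> w0 [[Cw cw _ _] Qw] rs tR e0 C0 g0 Hin Hbd x1 x1A.
rewrite leNgt; apply/negP => zx1.
pose A := [set x : 'rV[R]_N | s <= enorm x <= t].
have AO : A `<=` annulus_c r0 R0 by exact: shell_sub.
have {}cu := (subspace_continuousP _ _).1 (continuous_subspaceW AO cu).
have {}cv := (subspace_continuousP _ _).1 (continuous_subspaceW AO cv).
have {}cw := (subspace_continuousP _ _).1 (continuous_subspaceW AO cw).
pose z y := u y - e * v y.
have cz x : A x -> z y @[y --> within A (nbhs x)] --> z x.
  by move=> Ax; apply: cvgB; [exact: cu|apply: cvgMr; exact: cv].
have cz2 x : A x -> z y ^+ 2 @[y --> within A (nbhs x)] --> z x ^+ 2.
  by move=> Ax; rewrite expr2; apply: cvgM; exact: cz.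
have cz2' : {within A, continuous (fun y => z y ^+ 2)} by apply/subspace_continuousP.
have A0 : A !=set0 by exists x1.
have [xk _ kmax] := EVT_max_rV A0 (compact_shell s t) cz2'.
pose k := z xk ^+ 2.
have zk y : A y -> z y ^+ 2 <= k by move=> Ay; apply: kmax; exact/mem_set.
have k0 : 0 <= k by exact: sqr_ge0.
(* Small enough that the perturbation, at most [2 k dl], stays below [g]; the [+ 1] covers
   [k = 0]. *)
pose dl := g / (2 * k + 1).
have k10 : 0 < 2 * k + 1 by rewrite ltr_wpDl// mulr_ge0.
have dl0 : 0 < dl by rewrite divr_gt0.
have dlg : dl * (2 * k) < g.
  by rewrite /dl mulrAC ltr_pdivrMr// ltr_pM2l// ltrDl.
pose Z y := z y + dl * (k + z y ^+ 2).
have cZ : {within A, continuous (fun y => Z y / w y)}.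
  apply/subspace_continuousP => x Ax; apply: cvgM; last first.
    by apply: cvgV; [rewrite gt_eqF// w0//; exact: AO|exact: cw].
  apply: cvgD; first exact: cz.
  by apply: cvgMr; apply: cvgD; [exact: cvg_cst|exact: cz2].
have [x0 /set_mem x0A x0max] := EVT_max_rV A0 (compact_shell s t) cZ.
have {}x0max y : A y -> Z y / w y <= Z x0 / w x0.
  by move=> Ay; apply: x0max; exact/mem_set.
have wA y : A y -> 0 < w y by move=> Ay; apply: w0; exact: AO.
pose m := Z x0 / w x0.
have Cm : C < m.
  apply: lt_le_trans (x0max _ x1A); rewrite ltr_pdivlMr ?wA//.
  by apply: lt_le_trans zx1 _; rewrite lerDl mulr_ge0 ?addr_ge0 ?sqr_ge0// ltW.
(* On a boundary sphere [Z <= z + 2 k dl <= z + g <= C w], which contradicts [C < m]. *)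
have x0in : s < enorm x0 < t.
  have bd : ~ (enorm x0 = s \/ enorm x0 = t).
    move=> /Hbd /(_ x0A) zg; move: Cm; rewrite ltr_pdivlMr ?wA// ltNge => /negP; apply.
    apply: le_trans zg; rewrite lerD2l (le_trans _ (ltW dlg))// ler_pM2l//.
    by rewrite mulr_natl mulr2n lerD2l zk.
  by move: x0A => /andP[]; rewrite !le_eqVlt => /orP[/eqP xs|->] /orP[/eqP xt|->] //; case: bd; auto.
have x0O : annulus r0 R0 x0.
  have /andP[sx xt] := x0in; split; first exact: le_lt_trans sx.
  by apply: lt_trans tR; rewrite lte_fin.
have xr0 : 0 < enorm x0 by apply: lt_trans x0O.1.
have [du' Du0] := du.1 _ x0O.1 x0O.2.
have [dv' Dv0] := dv.1 _ x0O.1 x0O.2.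
have [uv Duv] := Hin _ x0in.
pose n := (enorm x0)^-1 *: x0.
have nE i : n ord0 i = x0 ord0 i / enorm x0 by rewrite mxE mulrC.
apply: (@no_contact R N p (- derive1 (profile u) (enorm x0))
  (- derive1 (profile v) (enorm x0)) e dl k m V u v w x0 n).
all: rewrite ?oppr_gt0 ?mulrN ?ltrN2 -/(z x0)//.
- exact: C2_on_diff2_at x0O.
- exact: C2_on_diff2_at x0O.
- exact: C2_on_diff2_at x0O.
- rewrite (eq_bigr (fun i => (enorm x0) ^- 2 * x0 ord0 i ^+ 2)); last first.
    by move=> i _; rewrite nE exprMn exprVn mulrC.
  by rewrite -mulr_sumr -sqr_enorm mulVf// gt_eqF// exprn_gt0.
- by move=> i; rewrite mulNr opprK nE; exact: (radial_gradient _ _ _ _ (ltW r00) ru x0O).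
- by move=> i; rewrite mulNr opprK nE; exact: (radial_gradient _ _ _ _ (ltW r00) rv x0O).
- by apply: v0; exact: AO.
- exact: wA.
- exact: V0.
- exact: Qu.
- exact: Qv.
- exact: Qw.
- exact: lt_trans Cm.
- exact: zk.
- by rewrite /m divfK// gt_eqF// wA.
have x0st : annulus s t%:E x0 by split; have /andP[] := x0in.
apply: filterS (near_annulus _ _ _ x0st) => y [sy yt].
have Ay : A y by rewrite /A /= ltW//= -lee_fin ltW.
by rewrite -ler_pdivrMr ?wA//; exact: x0max.
Qed.

(** * Monotonicity of the quotient of the profiles *)

Lemma is_derive_le0 {R : realType} (h : R -> R) (r d : R) :
  is_derive r 1 h d -> (\forall z \near r^'+, h z <= h r) -> d <= 0.
Proof.
move=> /is_derive1_caratheodory[k [hE kC kr]] hr; rewrite leNgt; apply/negP => d0.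
have k0 : \forall z \near r, 0 < k z by apply: (cvgr_gt _ kC); rewrite kr.
have : \forall z \near r^'+, False; last by move/filter_ex => [].
near=> z.
have rz : r < z by near: z; exact: nbhs_right_gt.
have kz : 0 < k z by near: z; exact: cvg_within.
have hz : h z <= h r by near: z.
have zr : 0 < z - r by rewrite subr_gt0.
by have := mulr_gt0 kz zr; rewrite -hE subr_gt0 ltNge hz.
Unshelve. all: by end_near. Qed.

Lemma toR0_proper {R : realType} (R0 : \bar R) : ProperFilter (toR0 R0).
Proof. by case: R0 => [a||] /=; exact: _. Qed.

Lemma near_toR0 {R : realType} (R0 : \bar R) (r1 : R) :
  (r1%:E < R0)%E -> \forall r \near toR0 R0, r1 < r /\ (r%:E < R0)%E.
Proof.
case: R0 => [a||//] /=.
  rewrite lte_fin => ra; near=> r; split; first by near: r; exact: nbhs_left_gt.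
  by rewrite lte_fin; near: r; exact: nbhs_left_lt.
move=> _; near=> r; split; last exact: ltry.
by near: r; apply: nbhs_pinfty_gt; exact: num_real.
Unshelve. all: by end_near. Qed.

(** The upper limit is an infimum of suprema over sets of the filter; one supremum is below [eta],
    and its set contains points beyond [r1]. *)
Lemma limf_esup_le0_lt {R : realType} (R0 : \bar R) (q : R -> R) (r1 eta : R) :
  (r1%:E < R0)%E -> ~ (0 < limf_esup (fun r => (q r)%:E) (toR0 R0))%E ->
  0 < eta -> exists r, [/\ r1 < r, (r%:E < R0)%E & q r < eta].
Proof.
move=> r1R /negP q0 eta0; rewrite -leNgt in q0.
have /ereal_inf_lt[_ [A FA <-] Aeta] :
    (ereal_inf [set ereal_sup ((fun r => (q r)%:E) @` A) | A in toR0 R0] < eta%:E)%E.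
  by rewrite -limf_esupE; apply: le_lt_trans q0 _; rewrite lte_fin.
have PF := toR0_proper R0.
have [r [Ar [r1r rR]]] := filter_ex (filterI FA (near_toR0 _ _ r1R)).
exists r; split=> //; rewrite -lte_fin; apply: le_lt_trans Aeta.
by apply: ereal_sup_ubound; exists r.
Qed.

Lemma profile_eq {R : realType} {N : nat} (r0 : R) (R0 : \bar R)
    (f : 'rV[R]_N -> R) (x : 'rV[R]_N) (r : R) :
  radial r0 R0 f -> annulus_c r0 R0 x -> enorm x = r -> f x = profile f r.
Proof. by move=> rf Ax <-; exact: rf. Qed.

Lemma profile_gt0 {R : realType} {N : nat} (r0 : R) (R0 : \bar R)
    (f : 'rV[R]_N -> R) (r : R) :
  (0 < N)%N -> 0 <= r0 -> positive_on r0 R0 f -> r0 <= r -> (r%:E < R0)%E ->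
  0 < profile f r.
Proof.
move=> N0 r00 f0 rr rR; have r_ge0 := le_trans r00 rr.
by apply: f0; split; rewrite enorm_const_mx.
Qed.

(** If the quotient rose from [s] to [r], a value [C] in between would exceed it at [s] and, the
    upper limit not being positive, again at some [t > r]. Comparison on the shell from [s] to [t]
    then gives [u <= C v] at [r]. *)
Lemma ratio_nonincreasing {R : realType} {N : nat} (p r0 : R) (R0 : \bar R)
    (V u v : 'rV[R]_N -> R) (s r : R) :
  (0 < N)%N -> 2 <= p -> 0 < r0 ->
  (forall x, annulus r0 R0 x -> 0 <= V x) ->
  [/\ positive_on r0 R0 u, radial r0 R0 u, strictly_decreasing r0 R0 u &
      subsolution p V r0 R0 u] ->
  [/\ positive_on r0 R0 v, radial r0 R0 v, strictly_decreasing r0 R0 v &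
      supersolution p V r0 R0 v] ->
  ~ (0 < limf_esup (fun r => (profile u r / profile v r)%:E) (toR0 R0))%E ->
  r0 <= s -> s <= r -> (r%:E < R0)%E ->
  profile u r / profile v r <= profile u s / profile v s.
Proof.
move=> N0 p2 r00 V0 Hu Hv lim0 rs sr rR; rewrite leNgt; apply/negP => qsr.
have [u0 ru _ _] := Hu; have [v0 rv _ Sv] := Hv.
have pu r' := profile_gt0 r0 R0 u r' N0 (ltW r00) u0.
have pv r' := profile_gt0 r0 R0 v r' N0 (ltW r00) v0.
have sR : (s%:E < R0)%E by apply: le_lt_trans rR; rewrite lee_fin.
have rr0 := le_trans rs sr.
have [sC Cr] := midf_lt qsr.
set C := (_ / 2) in sC Cr.
have C0 : 0 < C by apply: lt_trans sC; rewrite divr_gt0 ?pu ?pv.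
have [t [rt tR tC]] := limf_esup_le0_lt _ _ _ _ rR lim0 C0.
have tr0 := le_trans rr0 (ltW rt).
pose g := Num.min (C * profile v s - profile u s) (C * profile v t - profile u t).
have g0 : 0 < g.
  by rewrite lt_min !subr_gt0 -(ltr_pdivrMr _ _ (pv _ rs sR)) -(ltr_pdivrMr _ _ (pv _ tr0 tR)) sC.
pose x : 'rV[R]_N := const_mx (r / Num.sqrt N%:R).
have xr : enorm x = r by rewrite enorm_const_mx// (le_trans (ltW r00)).
have AO := shell_sub (N := N) r0 s t R0 rs tR.
have : u x - 0 * v x <= C * v x.
  (* Here [v] is also the supersolution [w], and [e = 0] reduces the interior conditions to [u > 0]
     and [u' < 0]. *)
  apply: (@shell_comparison R N p r0 R0 V u v v 0 C g s t) => //; last by rewrite xr sr ltW.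
    move=> y /andP[sy yt].
    have Ay : annulus_c r0 R0 y by apply: AO; rewrite /= (ltW sy) (ltW yt).
    rewrite !mul0r; split; first exact: u0.
    have [_ _ [du _] _] := Hu; apply: (du _ _ _).2; last exact: Ay.2.
    exact: le_lt_trans sy.
  move=> y yst yA; have Ay := AO _ yA.
  rewrite mul0r subr0 -lerBrDl.
  case: yst => yE; rewrite (profile_eq _ _ _ _ _ ru Ay yE) (profile_eq _ _ _ _ _ rv Ay yE).
    by rewrite ge_min lexx.
  by rewrite ge_min lexx orbT.
rewrite mul0r subr0 -[u x]/(profile u r) -[v x]/(profile v r) -ler_pdivrMr ?pv//.
by rewrite leNgt Cr.
Qed.

Lemma near_right_lt_ereal {R : realType} (R0 : \bar R) (r : R) :
  (r%:E < R0)%E -> \forall z \near r^'+, (z%:E < R0)%E.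
Proof.
case: R0 => [t|_|//]; last by apply: nearW => z; rewrite ltry.
by rewrite lte_fin => rt; near=> z; rewrite lte_fin; near: z; exact: nbhs_right_lt.
Unshelve. all: by end_near. Qed.

(** With [q] the quotient at [r], the function [u - q v] vanishes at [r] and is nonpositive to its
    right, so its derivative at [r] is nonpositive. *)
Lemma ratio_derive_le {R : realType} {N : nat} (p r0 : R) (R0 : \bar R)
    (V u v : 'rV[R]_N -> R) (r : R) :
  (0 < N)%N -> 2 <= p -> 0 < r0 ->
  (forall x, annulus r0 R0 x -> 0 <= V x) ->
  [/\ positive_on r0 R0 u, radial r0 R0 u, strictly_decreasing r0 R0 u &
      subsolution p V r0 R0 u] ->
  [/\ positive_on r0 R0 v, radial r0 R0 v, strictly_decreasing r0 R0 v &
      supersolution p V r0 R0 v] ->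
  ~ (0 < limf_esup (fun r => (profile u r / profile v r)%:E) (toR0 R0))%E ->
  r0 < r -> (r%:E < R0)%E ->
  derive1 (profile u) r <= profile u r / profile v r * derive1 (profile v) r.
Proof.
move=> N0 p2 r00 V0 Hu Hv lim0 rr rR.
have [u0 ru [du _] _] := Hu; have [v0 rv [dv _] _] := Hv.
set q := profile u r / profile v r.
have pv r' := profile_gt0 r0 R0 v r' N0 (ltW r00) v0.
have vr0 : 0 < profile v r by apply: pv => //; exact: ltW.
have [/derivableP Du _] := du _ rr rR; have [/derivableP Dv _] := dv _ rr rR.
rewrite -subr_le0.
have D := is_deriveB Du (@is_deriveZ _ _ _ _ q _ _ _ Dv).
rewrite !derive1E; apply: (is_derive_le0 _ _ _ D).
rewrite !fctE /= /GRing.scale /=.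
near=> z.
rewrite [leRHS](_ : _ = 0); last by rewrite /q divfK ?subrr// gt_eqF.
have zR : (z%:E < R0)%E by near: z; exact: near_right_lt_ereal.
have rz : r <= z by apply/ltW; near: z; exact: nbhs_right_gt.
have vz0 : 0 < profile v z by apply: pv => //; apply: le_trans rz; exact: ltW.
rewrite subr_le0 -ler_pdivrMr//.
by apply: (ratio_nonincreasing p r0 R0 V u v) => //; exact: ltW.
Unshelve. all: by end_near. Qed.

(** * The alternative *)

Theorem theorem3p5 (R : realType) (N : nat) (p r0 : R) (R0 : \bar R)
    (V : 'rV[R]_N -> R) (u : 'rV[R]_N -> R) :
  (2 <= N)%N -> 2 <= p -> 0 < r0 -> (r0%:E < R0)%E ->
  (forall x, annulus r0 R0 x -> {for x, continuous V}) ->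
  ((forall x, annulus r0 R0 x -> 0 < V x) \/ (forall x, annulus r0 R0 x -> V x = 0)) ->
  cond_star p V r0 R0 ->
  (exists v, [/\ positive_on r0 R0 v, radial r0 R0 v, strictly_decreasing r0 R0 v &
                 supersolution p V r0 R0 v]) ->
  [/\ positive_on r0 R0 u, radial r0 R0 u, strictly_decreasing r0 R0 u &
      subsolution p V r0 R0 u] ->
  (forall w, positive_on r0 R0 w -> supersolution p V r0 R0 w ->
     exists C : R, 0 < C /\ forall x, annulus_c r0 R0 x -> u x <= C * w x)
  \/
  (forall v, [/\ positive_on r0 R0 v, radial r0 R0 v, strictly_decreasing r0 R0 v &
                 supersolution p V r0 R0 v] ->
     (0 < limf_esup (fun r => (profile u r / profile v r)%:E) (toR0 R0))%E).
Proof.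
move=> N2 p2 r00 rR0 _ Vsign _ _ Hu.
have N0 : (0 < N)%N by apply: leq_trans N2.
have V0 x : annulus r0 R0 x -> 0 <= V x.
  by move=> Ax; case: Vsign => HV; [exact: ltW (HV x Ax)|rewrite HV].
(* If (i) fails and some [v] violates (ii), then (i) is proved after all, for an arbitrary [w]. *)
apply/or_asboolP; rewrite -implyNb; apply/implyP => /asboolPn noti.
apply/asboolP => v Hv; apply: contrapT => lim0; apply: noti => w w0 Sw.
have [u0 ru _ _] := Hu; have [v0 rv [dv _] _] := Hv.
have cw : {within annulus_c r0 R0, continuous w} by case: Sw => -[].
pose q r := profile u r / profile v r.
have pv r := profile_gt0 r0 R0 v r N0 (ltW r00) v0.
have pu r := profile_gt0 r0 R0 u r N0 (ltW r00) u0.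
have sphere_bound r : r0 <= r -> (r%:E < R0)%E ->
    exists2 m : R, 0 < m & forall x, enorm x = r -> m <= w x.
  move=> rr rR; have sO := shell_sub (N := N) r0 r r R0 rr rR.
  have [||m m0 Hm] := @shell_lower_bound R N r r w.
  - exact: continuous_subspaceW cw.
  - by move=> x xA; apply: w0; exact: sO.
  - by exists m => // x xr; apply: Hm; rewrite xr lexx.
have [m m0 wm] := sphere_bound r0 (lexx _) rR0.
(* Depends on the inner sphere only, not on the outer radius [t] chosen later; the [+ 1] leaves room
   for the slack [g]. *)
pose C := (profile u r0 + 1) / m.
have ur0 := pu r0 (lexx _) rR0.
have C0 : 0 < C by rewrite divr_gt0// addr_gt0.
have bd0 x : enorm x = r0 -> profile u r0 + 1 <= C * w x.
  move=> xr; rewrite -[leLHS](divfK (lt0r_neq0 m0)) ler_pM2l//; exact: wm.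
exists C; split=> // x Ax; have [r0x xR] := Ax.
have [xr0|xr0] := eqVneq (enorm x) r0.
  apply: le_trans (bd0 x xr0).
  by rewrite (profile_eq _ _ _ _ _ ru Ax xr0) lerDl.
have {}r0x : r0 < enorm x by rewrite lt_def xr0.
rewrite leNgt; apply/negP => uCw.
have vx0 := v0 _ Ax.
(* If [u x > C w x], this positive number is the threshold that the quotient [q] must undercut at
   some [t] beyond [enorm x]. *)
have eta0 : 0 < (u x - C * w x) / v x by rewrite divr_gt0// subr_gt0.
have [t [xt tR qt]] := limf_esup_le0_lt _ q _ _ xR lim0 eta0.
have r0t := lt_trans r0x xt.
have vt0 := pv t (ltW r0t) tR; have ut0 := pu t (ltW r0t) tR.
have [m3 m30 wm3] := sphere_bound t (ltW r0t) tR.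
have q0 : 0 < q t by rewrite divr_gt0.
have Cm0 : 0 < C * m3 / 2 by rewrite divr_gt0// mulr_gt0.
(* On the outer sphere [u - e v = kappa v(t)], at most half of [C m3]; the other half is for [g].
   The bound by [q t] keeps [e >= 0]. *)
pose kappa := Num.min (q t) (C * m3 / 2 / profile v t).
have kappa0 : 0 < kappa by rewrite lt_min q0 divr_gt0.
pose e := q t - kappa.
have e0 : 0 <= e by rewrite subr_ge0 ge_min lexx.
have eq : e < q t by rewrite gtrBl.
pose g := Num.min 1 (C * m3 / 2).
have g0 : 0 < g by rewrite lt_min ltr01.
have AO := shell_sub (N := N) r0 r0 t R0 (lexx _) tR.
have : u x - e * v x <= C * w x.
  apply: (@shell_comparison R N p r0 R0 V u v w e C g r0 t) => //.
  - move=> y /andP[ry yt].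
    have Ay : annulus_c r0 R0 y by apply: AO; rewrite /= !ltW.
    (* Both interior conditions follow from [e < q t <= q (enorm y)]; the one on derivatives also
       uses [u' <= q v'] and [v' < 0]. *)
    have qy : q t <= q (enorm y).
      by apply: (ratio_nonincreasing p r0 R0 V u v) => //; exact: ltW.
    have vy0 : 0 < profile v (enorm y) by apply: pv; [exact: ltW|exact: Ay.2].
    split.
      rewrite (ru _ Ay) (rv _ Ay) -ltr_pdivlMr//.
      exact: lt_le_trans qy.
    apply: le_lt_trans (ratio_derive_le p r0 R0 V u v _ N0 p2 r00 V0 Hu Hv lim0 ry Ay.2) _.
    rewrite ltr_nM2r; first exact: lt_le_trans qy.
    by have [] := dv _ ry Ay.2.
  - move=> y [yr0|yt] yA; have Ay := AO _ yA.
      rewrite (profile_eq _ _ _ _ _ ru Ay yr0); apply: le_trans (bd0 y yr0).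
      rewrite lerD ?ge_min ?lexx// gerBl mulr_ge0// ltW//; exact: v0.
    rewrite (profile_eq _ _ _ _ _ ru Ay yt) (profile_eq _ _ _ _ _ rv Ay yt).
    have wy : C * m3 <= C * w y by rewrite ler_pM2l//; exact: wm3.
    apply: le_trans wy; rewrite [leRHS]splitr lerD ?ge_min ?lexx ?orbT//.
    rewrite /e mulrBl divfK ?gt_eqF// opprB addrC subrK.
    by rewrite -ler_pdivlMr// ge_min lexx orbT.
  - by rewrite !ltW.
(* The comparison at [x] would force [e] to be at least the threshold, whereas [e < q t] and [q t]
   lies below it. *)
apply/negP; rewrite -ltNge ltrBrDr -ltrBrDl -ltr_pdivlMr//.
exact: lt_trans qt.
Qed.
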